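(* Let $T$ be a finite tree with at least one edge, $L(T)$ its combinatorial Laplacian and $\operatorname{Line}(T)$ its line graph. Then $$\lambda_1(L(T))=2+\lambda_{\min}\big(A(\operatorname{Line}(T))\big),\qquad \lambda_{\max}(L(T))=2+\lambda_{\max}\big(A(\operatorname{Line}(T))\big),$$ and the identity $\lambda_1(L(T))=2-\lambda_{\max}\big(A(\operatorname{Line}(T))\big)$ holds if and only if $T$ is a path.
   Context: For a graph $H$, $A(H)$ is its adjacency matrix and $L(H)=\operatorname{diag}(\deg)-A(H)$. $\lambda_1(L(T))$ is the smallest nonzero eigenvalue and $\lambda_{\max}(L(T))$ the largest eigenvalue of $L(T)$; $\lambda_{\min},\lambda_{\max}$ of an adjacency matrix are its smallest and largest eigenvalues. The vertices of $\operatorname{Line}(T)$ are the edges of $T$, two being adjacent when they share a vertex. *)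

(* Defs.v *)
From mathcomp Require Import all_boot all_order all_algebra.
From mathcomp Require Import polyrcf.

Set Implicit Arguments.
Unset Strict Implicit.
Unset Printing Implicit Defensive.

Import Order.TTheory GRing.Theory Num.Theory.
Local Open Scope ring_scope.

Record sgraph := SGraph {
  vertex :> finType;
  adj : rel vertex;
  adj_sym : symmetric adj;
  adj_irr : irreflexive adj }.

Section Graphs.
Variable G : sgraph.

Definition deg (x : G) : nat := #|[set y | adj x y]|.

Definition edge_set : {set {set G}} :=
  [set [set p.1; p.2] | p : G * G & adj p.1 p.2].

Definition edge : finType := {E : {set G} | E \in edge_set}.

Definition share_vertex : rel edge :=
  fun E F => (E != F) && (val E :&: val F != set0).

Lemma share_vertex_sym : symmetric share_vertex.
Proof. by move=> E F; rewrite /share_vertex eq_sym setIC. Qed.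

Lemma share_vertex_irr : irreflexive share_vertex.
Proof. by move=> E; rewrite /share_vertex eqxx. Qed.

Definition line_graph : sgraph := SGraph share_vertex_sym share_vertex_irr.

Definition connected_graph : Prop :=
  (0 < #|G|)%N /\ forall x y : G, connect (@adj G) x y.

(* The size condition is needed because [:: x; y] is a [ucycle] as soon as
   x and y are adjacent. *)
Definition acyclic : Prop :=
  forall c : seq G, (2 < size c)%N -> ~ ucycle (@adj G) c.

Definition is_tree : Prop := connected_graph /\ acyclic.

Definition is_path_graph : Prop :=
  exists f : 'I_#|G| -> G, bijective f /\
    forall i j : 'I_#|G|, adj (f i) (f j) = (i.+1 == j :> nat) || (j.+1 == i :> nat).

End Graphs.

Section Matrices.
Variables (R : rcfType) (G : sgraph).

(* Rows and columns are indexed by the canonical enumeration of the vertices. *)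
Definition adjacency : 'M[R]_#|G| :=
  \matrix_(i, j) (adj (enum_val i) (enum_val j))%:R.

Definition laplacian : 'M[R]_#|G| :=
  diag_mx (\row_i (deg (enum_val i))%:R) - adjacency.

End Matrices.

Section Spectrum.
Variables (R : rcfType) (n : nat) (A : 'M[R]_n).

(* Increasing, without multiplicities. *)
Definition spectrum : seq R := rootsR (char_poly A).

Lemma mem_spectrum a : (a \in spectrum) = eigenvalue A a.
Proof.
have p0 : char_poly A != 0 by rewrite monic_neq0 ?char_poly_monic.
by rewrite eigenvalue_root_char -(roots_on_rootsR p0) in_itv.
Qed.

Lemma sorted_spectrum : sorted <%R spectrum.
Proof. exact: sorted_roots. Qed.

(* The three definitions below return 0 by convention when there is no such
   eigenvalue. *)
Definition lambda_min : R := head 0 spectrum.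
Definition lambda_max : R := last 0 spectrum.
Definition lambda_1 : R := head 0 [seq a <- spectrum | a != 0].

Lemma lambda_minP a :
  eigenvalue A a -> eigenvalue A lambda_min /\ lambda_min <= a.
Proof.
rewrite -!mem_spectrum /lambda_min; have := sorted_spectrum.
case: spectrum => [//|b s] ss abs; split; first exact: mem_head.
move: abs; rewrite inE => /predU1P[-> //|].
by move=> /(allP (order_path_min lt_trans ss)) /ltW.
Qed.

Lemma lambda_maxP a :
  eigenvalue A a -> eigenvalue A lambda_max /\ a <= lambda_max.
Proof.
rewrite -!mem_spectrum /lambda_max; have := sorted_spectrum.
case: (lastP spectrum) => [//|s b] ss abs; rewrite last_rcons.
split; first by rewrite mem_rcons mem_head.
move: ss abs; rewrite (sorted_pairwise lt_trans) pairwise_rcons => /andP[/allP sb _].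
by rewrite mem_rcons inE => /predU1P[-> //|/sb /ltW].
Qed.

Lemma lambda_1P a : eigenvalue A a -> a != 0 ->
  [/\ eigenvalue A lambda_1, lambda_1 != 0 & lambda_1 <= a].
Proof.
rewrite -!mem_spectrum /lambda_1 => sa a0.
have : a \in [seq b <- spectrum | b != 0] by rewrite mem_filter a0.
have := sorted_filter lt_trans (fun b => b != 0) sorted_spectrum.
have : {subset [seq b <- spectrum | b != 0]
    <= [pred b | (b != 0) && (b \in spectrum)]}.
  by move=> b; rewrite mem_filter inE.
case: [seq b <- spectrum | b != 0] => [//|b s] sub ss abs.
have /sub/andP[b0 sb] := mem_head b s; split=> //.
move: abs; rewrite inE => /predU1P[-> //|].
by move=> /(allP (order_path_min lt_trans ss)) /ltW.
Qed.

End Spectrum.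

(* Main.v *)
(** Let [N] be the unsigned incidence matrix of the tree.  Then
    [N N^T = 2 + A(Line T)], while a proper 2-colouring of [T] conjugates
    [N^T N = deg + A(T)] to [L(T)]; since [N] is injective on edge functions
    (look at a leaf of the support), the spectrum of [2 + A(Line T)] is exactly
    the nonzero spectrum of [L(T)], and it is positive.  If [T] has a vertex of
    degree at least 3, its star is a clique of [Line T] forcing
    [lambda_max (A(Line T)) >= 2], so the last identity would contradict
    [lambda_1 (L(T)) > 0]; otherwise a longest path exhausts [T].  Conversely
    the line graph of a path is bipartite, so its spectrum is symmetric. *)
Require Import Defs.
From mathcomp Require Import all_boot all_order all_algebra.
From mathcomp Require Import complex.
From mathcomp Require Import zify ring lra.

Set Implicit Arguments.
Unset Strict Implicit.
Unset Printing Implicit Defensive.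

Import Order.TTheory GRing.Theory Num.Theory.
Local Open Scope ring_scope.

(** * Acyclic graphs: leaves, two-colourings, recognition of paths *)

Section Forests.
Local Open Scope nat_scope.

Variable G : sgraph.

(** As for [path], the start [x] is kept outside [p], so [size p] counts edges. *)
Definition path_in (S : {set G}) (x : G) (p : seq G) :=
  [&& path (@adj G) x p, uniq (x :: p) & all (mem S) (x :: p)].

Lemma longest_path_in (S : {set G}) : S != set0 ->
  exists x p, path_in S x p /\
    forall y q, path_in S y q -> (size q <= size p)%N.
Proof.
case/set0Pn=> x0 Sx0.
pose P k := [exists x, exists p : k.-tuple G, path_in S x p].
have P0 : P 0%N.
  apply/existsP; exists x0; apply/existsP; exists [tuple].
  by rewrite /path_in /= Sx0.
have Pmax k : P k -> (k <= #|G|)%N.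
  case/existsP=> x /existsP[p /and3P[_ Up _]].
  rewrite -(size_tuple p) -ltnS; apply: leq_trans (leqnSn _).
  by rewrite -/(size (x :: p)) -(card_uniqP Up) max_card.
case: (ex_maxnP (ex_intro (fun k => is_true (P k)) _ P0) Pmax) => k Pk maxk.
case/existsP: Pk => x /existsP[p xp]; exists x, p; split=> // y q yq.
rewrite size_tuple; apply: maxk; apply/existsP; exists y.
by apply/existsP; exists (in_tuple q).
Qed.

Hypothesis acyclicG : acyclic G.

(** A nonempty [p] would make [x :: rcons p y] a cycle on at least three vertices. The tail [q] lets
    the lemma apply inside a longer path. *)
Lemma acyclic_no_chord (x y : G) (p q : seq G) :
    path (@adj G) x (rcons p y ++ q) -> uniq (x :: rcons p y ++ q) ->
  adj x y -> p = [::].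
Proof.
case: p => // z p; rewrite cat_path -cat_cons cat_uniq => /andP[xp _] /andP[Up _].
move=> xy; case: (acyclicG (c := x :: rcons (z :: p) y)).
  by rewrite /= size_rcons.
by rewrite /ucycle Up andbT /= rcons_path last_rcons (adj_sym y) xy andbT; move: xp.
Qed.

(** Take an end of a longest path in [S]: a neighbour in [S] off the path would extend it, and one
    on the path is the next vertex, since chords are excluded. *)
Lemma acyclic_leaf (S : {set G}) : S != set0 ->
  exists2 x, x \in S & {in S &, forall y z, adj x y -> adj x z -> y = z}.
Proof.
case/longest_path_in=> x [p [/and3P[xp Up Sp] maxp]].
exists x; first by case/andP: Sp.
suff nbr y : y \in S -> adj x y -> exists q, p = y :: q.
  by move=> y z Sy Sz /(nbr _ Sy)[q pE] /(nbr _ Sz)[r]; rewrite pE => -[->].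
move=> Sy xy; have [py | pNy] := boolP (y \in p).
  case/splitPr: py xp Up {Sp maxp} => p1 p2; rewrite -cat_rcons => xp Up.
  by rewrite (acyclic_no_chord xp Up xy); exists p2.
suff /maxp : path_in S y (x :: p) by rewrite /= ltnn.
rewrite /path_in /= adj_sym xy xp [y \in S]Sy.
rewrite inE negb_or pNy andbT; move: Up Sp => /= -> ->; rewrite !andbT.
by apply: contraTneq xy => ->; rewrite adj_irr.
Qed.

(** Induction on [#|S|]: colour [S] minus a leaf, then give the leaf the colour opposite to that of
    its only possible neighbour. *)
Lemma acyclic_bipartite :
  exists c : G -> bool, forall x y, adj x y -> c x = ~~ c y.
Proof.
suff col n (S : {set G}) : #|S| = n ->
    exists c : G -> bool, {in S &, forall x y, adj x y -> c x = ~~ c y}.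
  by have [c cP] := col _ setT erefl; exists c => x y; apply: cP.
elim: n S => [|n IHn] S Sn.
  by exists xpredT => x y; rewrite (cards0_eq Sn) inE.
have /acyclic_leaf[x Sx leafx] : S != set0 by rewrite -card_gt0 Sn.
have [|c cP] := IHn (S :\ x); first by have := cardsD1 x S; rewrite Sx Sn => -[].
pose d := if [pick y in S | adj x y] is Some y then ~~ c y else true.
have dP y : y \in S -> adj x y -> d = ~~ c y.
  move=> Sy xy; rewrite /d; case: pickP => [z /andP[Sz xz] | /(_ y)].
    by rewrite (leafx _ _ Sy Sz).
  by rewrite Sy xy.
exists (fun y => if y == x then d else c y) => y z Sy Sz yz.
case: eqP yz => [-> | /eqP yx] yz; case: eqP yz => [-> | /eqP zx] yz.
- by rewrite adj_irr in yz.
- exact: dP.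
- by rewrite (dP y) ?negbK // adj_sym.
- by apply: cP; rewrite // !inE ?yx ?zx.
Qed.

Lemma path_graph_of_deg_le2 :
  connected_graph G -> (forall x : G, (deg x <= 2)%N) -> is_path_graph G.
Proof.
case=> G0 connG deg2.
have /longest_path_in[x [p [/and3P[xp Up _] maxp]]] : [set: G] != set0.
  by rewrite -card_gt0 cardsT.
have {}maxp y q : path (@adj G) y q -> uniq (y :: q) -> (size q <= size p)%N.
  move=> yq Uq; apply: (maxp y); rewrite /path_in yq Uq.
  by apply/allP=> z _; apply: in_setT.
(* No edge leaves the longest path: at either end it would give a longer path, and an interior
   vertex would get a third neighbour. *)
have clos u w : u \in x :: p -> adj u w -> w \in x :: p.
  move=> pu uw; apply: contraT => wNp.
  move: pu; rewrite inE => /predU1P[ux | pu].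
    have := maxp w (x :: p); rewrite /= ltnn; move: Up wNp => /= -> ->.
    by rewrite xp adj_sym -ux uw => /(_ isT isT).
  case/splitPr: p / pu xp Up maxp wNp => p1 p2 xp Up maxp wNp.
  case: p2 xp Up maxp wNp => [|b p2] xp Up maxp wNp.
    rewrite cats1 in xp Up wNp maxp.
    have := maxp x (rcons (rcons p1 u) w).
    rewrite size_rcons ltnn -rcons_cons rcons_uniq rcons_path last_rcons.
    by rewrite xp uw wNp Up => /(_ isT isT).
  move: xp; rewrite cat_path /= => /and4P[_ au ub _].
  (* The predecessor [last x p1], the successor [b] and the outside vertex [w] are three distinct
     neighbours of [u]. *)
  suff : (#|last x p1 |: [set b; w]| <= deg u)%N.
    rewrite cardsU1 cards2 !inE negb_or.
    move=> /leq_trans/(_ (deg2 u)).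
    have -> /= : last x p1 != b.
      apply: contraTneq Up => <-.
      rewrite -cat_cons cat_uniq; apply/negP => /and3P[_ /hasPn/(_ (last x p1))].
      by rewrite /= mem_last in_cons mem_head orbT => /(_ isT).
    have bw : b != w.
      by apply: contraNneq wNp => <-; rewrite inE mem_cat !inE eqxx !orbT.
    have -> : last x p1 != w.
      apply: contraNneq wNp => <-.
      by rewrite -cat_cons mem_cat mem_last.
    by rewrite bw.
  apply: subset_leq_card; apply/subsetP => z.
  by rewrite !inE => /or3P[] /eqP->; rewrite // adj_sym.
have cover y : y \in x :: p.
  have clo : closed (@adj G) (mem (x :: p)).
    apply: intro_closed; first by apply: sym_connect_sym; apply: adj_sym.
    by move=> u w uw pu; apply: clos uw.
  by rewrite -(closed_connect clo (connG x y)) mem_head.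
have sizeG : #|G| = (size p).+1.
  rewrite -/(size (x :: p)) -(card_uniqP Up); apply: eq_card => y.
  by rewrite cover.
have ltp (i : 'I_#|G|) : (i < size (x :: p))%N by rewrite /= -sizeG.
exists (fun i => nth x (x :: p) i); split.
  apply: inj_card_bij; last by rewrite card_ord.
  by move=> i j /eqP; rewrite nth_uniq // => /eqP/val_inj.
have cons i j : (i < j < size (x :: p))%N ->
    adj (nth x (x :: p) i) (nth x (x :: p) j) = (i.+1 == j).
  case/andP=> ij jp; have ip := ltn_trans ij jp.
  apply/idP/eqP => [aij | <-]; last first.
    by have /pathP := xp; apply; rewrite -ltnS (leq_ltn_trans ij).
  (* Cut the path at positions [i] and [j]: the edge between them is a chord unless the stretch
     strictly between, of length [j - i.+1], is empty. *)
  have Esp : x :: p = take i (x :: p) ++ nth x (x :: p) i :: drop i.+1 (x :: p).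
    by rewrite -drop_nth // cat_take_drop.
  have Ed : drop i.+1 (x :: p) =
      rcons (take (j - i.+1) (drop i.+1 (x :: p))) (nth x (x :: p) j)
        ++ drop j.+1 (x :: p).
    rewrite cat_rcons -{1}(cat_take_drop (j - i.+1) (drop i.+1 (x :: p))).
    by rewrite drop_drop subnK // (drop_nth x jp).
  set a := nth x _ i in aij Esp; set b := nth x _ j in aij Ed.
  have pab : path (@adj G) a (drop i.+1 (x :: p)).
    have : sorted (@adj G) (x :: p) by [].
    by rewrite {1}Esp => /cat_sorted2[].
  have Uab : uniq (a :: drop i.+1 (x :: p)).
    by have := Up; rewrite {1}Esp cat_uniq => /and3P[].
  rewrite Ed in pab Uab.
  have /(congr1 size) := acyclic_no_chord pab Uab aij.
  rewrite size_takel ?size_drop ?leq_sub2r 1?ltnW //= => /eqP.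
  by rewrite subn_eq0 => ji; apply/eqP; rewrite eqn_leq ij.
move=> i j; case: (ltngtP i j) => [ij | ji | /val_inj <-].
- by rewrite cons ?ij ?ltp // [j.+1 == i]gtn_eqF ?orbF // ltnS ltnW.
- by rewrite adj_sym cons ?ji ?ltp // [i.+1 == j]gtn_eqF // ltnS ltnW.
- by rewrite adj_irr orbb gtn_eqF.
Qed.

End Forests.

(** * Rayleigh quotients of symmetric matrices *)

Section Rayleigh.
Local Open Scope sesquilinear_scope.

(* The spectral theorem is available over closed fields only, hence the detour
   through [R[i]]. *)
Lemma eigenvalue_ge_rayleigh (R : rcfType) (n : nat) (A : 'M[R]_n)
    (v : 'rV[R]_n) (m : R) :
    A^T = A -> v != 0 -> m * (v *m v^T) 0 0 <= (v *m A *m v^T) 0 0 ->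
  exists2 a, eigenvalue A a & m <= a.
Proof.
move=> Asym v0 lem.
pose c : {rmorphism R -> R[i]} := real_complex R.
pose B := map_mx c A; pose w := map_mx c v.
have cJ (x : R) : Num.conj (c x) = c x by apply/CrealP/complex_realP; exists x.
have Bsym : B \is symmetricmx.
  by apply/is_hermitianmxP; rewrite expr0 scale1r map_mx_id // /B map_trmx Asym.
have Breal : B \is a realmx by apply/mxOverP => i j; apply/CrealP; rewrite mxE cJ.
have Bherm := realsym_hermsym Bsym Breal.
have Dreal := hermitian_spectral_diag_real Bherm.
have BE := orthomx_spectralP (hermitian_normalmx Bherm).
have := spectral_unitarymx B; have := spectral_unit B.
move: BE Dreal; set P := spectralmx B; set D := spectral_diag B.
move=> BE /mxOverP Dreal Pu PU.
(* Coordinates of [w] in the orthonormal eigenbasis formed by the rows of [P]; both quadratic forms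
   become weighted sums of the [|u_i|^2]. *)
pose u := w *m invmx P.
have wE : w = u *m P by rewrite mulmxKV.
have wJ : w^T = w^t* by apply/matrixP=> i j; rewrite !mxE cJ.
have iPJ : P *m P^t* = 1%:M by apply/unitarymxP.
have wJE : w^T = P^t* *m u^t* by rewrite wJ wE trmx_mul map_mxM.
have normE : c ((v *m v^T) 0 0) = \sum_i `|u 0 i| ^+ 2.
  have -> : c ((v *m v^T) 0 0) = (w *m w^T) 0 0.
    by rewrite map_trmx -map_mxM [RHS]mxE.
  rewrite wJE wE mulmxA -(mulmxA u) iPJ mulmx1 mxE.
  by apply: eq_bigr => i _; rewrite !mxE normCK.
have rayE : c ((v *m A *m v^T) 0 0) = \sum_i D 0 i * `|u 0 i| ^+ 2.
  have -> : c ((v *m A *m v^T) 0 0) = (w *m B *m w^T) 0 0.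
    by rewrite map_trmx -!map_mxM [RHS]mxE.
  rewrite wJE BE wE !mulmxA mulmxK // -(mulmxA _ P) iPJ mulmx1 mxE.
  apply: eq_bigr => i _; rewrite mul_mx_diag !mxE normCK.
  by rewrite mulrAC mulrC mulrA mulrC.
(* If every [D 0 i] were below [m], so would be the Rayleigh quotient, strictly because some
   coordinate of [u] is nonzero. *)
have [i leD] : exists i, c m <= D 0 i.
  apply/existsP; apply: contraLR lem => /existsPn ltD.
  rewrite -ltNge -ltcR -!/(c _) rmorphM /= -/c normE rayE mulr_sumr.
  have {}ltD i : D 0 i < c m.
    by rewrite real_ltNge ?ltD ?Dreal //; apply/CrealP; rewrite cJ.
  have [i ui0] : exists i, u 0 i != 0.
    apply/existsP; apply: contraNT v0 => /existsPn u0.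
    have u00 : u = 0 by apply/rowP => i; rewrite [RHS]mxE; apply/eqP/negPn/u0.
    by rewrite -(map_mx_eq0 c) -/w wE u00 mul0mx.
  rewrite (bigD1 i) //= [ltRHS](bigD1 i) //= ltr_leD //.
    by rewrite ltr_pM2r // exprn_gt0 // normr_gt0.
  by apply: ler_sum => j _; rewrite ler_wpM2r ?exprn_ge0 // ltW.
(* [D 0 i] is real, hence comes from some [a] in [R]; the eigenvector over [R[i]] is [row i P], and
   being an eigenvalue descends to [R]. *)
have /complex_realP[a Da] := Dreal 0 i.
exists a; last by rewrite -lecR -Da.
rewrite -(eigenvalue_map c) -/B; apply/eigenvalueP; exists (row i P).
  rewrite BE !mulmxA -row_mul mulmxV // row1 -rowE row_diag_mx Da -scalemxAl.
  by rewrite -rowE.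
apply: contraTneq isT => Pi0; have := row1 R[i] i.
rewrite -(mulmxV Pu) row_mul Pi0 mul0mx => /rowP/(_ i).
by rewrite !mxE !eqxx => /esym/eqP; rewrite oner_eq0.
Qed.

End Rayleigh.

(** * Edges as two-element sets, and the incidence operators *)

Section Edges.
Variable G : sgraph.

Lemma edge_setP (E : {set G}) :
  reflect (exists x y, adj x y /\ E = [set x; y]) (E \in edge_set G).
Proof.
apply: (iffP imsetP) => [[[x y]] | [x [y [xy ->]]]].
  by rewrite inE /= => xy ->; exists x, y.
by exists (x, y); rewrite ?inE.
Qed.

Lemma adj_neq (x y : G) : adj x y -> x != y.
Proof. by apply: contraTneq => ->; rewrite adj_irr. Qed.

Lemma edge_at (E : {set G}) (x : G) :
  E \in edge_set G -> x \in E -> exists2 y, adj x y & E = [set x; y].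
Proof.
case/edge_setP=> u [w [uw ->]]; rewrite !inE => /orP[] /eqP->; first by exists w.
by exists u; rewrite 1?adj_sym // setUC.
Qed.

(** The entries of [N N^T = 2 + A(Line)]: distinct edges have at most one common vertex. *)
Lemma card_edgeI (e f : edge G) :
  #|val e :&: val f| = ((e == f).*2 + share_vertex e f)%N.
Proof.
have card_edge (E : edge G) : #|val E| = 2%N.
  by have /edge_setP[x [y [/adj_neq xy ->]]] := valP E; rewrite cards2 xy.
rewrite /share_vertex; case: eqVneq => [<- | ef] /=.
  by rewrite setIid card_edge addn0.
rewrite add0n -card_gt0; have : (#|val e :&: val f| < 2)%N.
  rewrite ltnNge; apply: contraNN ef => le2; apply/eqP/val_inj.
  have /eqP <- : val e :&: val f == val e.
    by rewrite eqEcard subsetIl card_edge.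
  by apply/eqP; rewrite eqEcard subsetIr card_edge.
by case: #|_| => [|[]].
Qed.

(** The map [y |-> {x, y}] is a bijection from the neighbours of [x] to the edges at [x]. Taking [F]
    on all sets spares a membership proof for [[set x; y]]. *)
Lemma sum_edges_at (V : nmodType) (x : G) (F : {set G} -> V) :
  \sum_(e : edge G | x \in val e) F (val e) = \sum_(y | adj x y) F [set x; y].
Proof.
rewrite -(big_sub_cond _ (fun E : {set G} => x \in E)).
transitivity (\sum_(E in [set [set x; y] | y in [pred y | adj x y]]) F E).
  apply: eq_bigl => E; apply/andP/imsetP => [[eE xE] | [y xy ->]].
    by have [y xy ->] := edge_at eE xE; exists y.
  by rewrite !inE eqxx; split=> //; apply/edge_setP; exists x, y.
apply: big_imset => y z xy xz /setP/(_ y).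
by rewrite !inE eqxx orbT eq_sym (negbTE (adj_neq xy)) => /esym/eqP.
Qed.

Lemma sum_edge_ends (V : nmodType) (x y : G) (h : G -> V) :
  adj x y -> \sum_(z in [set x; y]) h z = h x + h y.
Proof. by move=> /adj_neq xy; rewrite big_setU1 ?big_set1 ?inE. Qed.

(** This is [N^T N = deg + A] applied to [h], at the vertex [x]. *)
Lemma sum_edges_at_ends (V : nmodType) (x : G) (h : G -> V) :
  \sum_(e : edge G | x \in val e) \sum_(z in val e) h z
    = \sum_(y | adj x y) (h x + h y).
Proof.
rewrite (sum_edges_at x (fun E => \sum_(z in E) h z)).
by apply: eq_bigr => y /sum_edge_ends.
Qed.

(** This is [N N^T = 2 + A(Line)] applied to [g]: after exchanging the sums, [g f] occurs once for
    each common vertex of [e] and [f]. *)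
Lemma sum_ends_edges_at (V : nmodType) (e : edge G) (g : edge G -> V) :
  \sum_(z in val e) \sum_(f : edge G | z \in val f) g f
    = g e *+ 2 + \sum_(f | share_vertex e f) g f.
Proof.
rewrite (exchange_big_dep xpredT) //=.
transitivity (\sum_f g f *+ ((e == f).*2 + share_vertex e f)).
  apply: eq_bigr => f _; rewrite -card_edgeI sumr_const; congr (_ *+ _).
  by apply: eq_card => z; rewrite !inE.
rewrite (bigD1 e) //= eqxx share_vertex_irr; congr (_ + _).
rewrite [RHS]big_mkcond [RHS](bigD1 e) //= share_vertex_irr add0r.
apply: eq_bigr => f fe; rewrite eq_sym (negbTE fe) /=.
by case: share_vertex.
Qed.

(** Let [S] be the set of vertices covered by the support of [g]. A leaf of [S] lies on exactly one
    edge of the support, so the sum there is a single nonzero term. *)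
Lemma acyclic_incidence_inj (V : nmodType) (g : edge G -> V) (e0 : edge G) :
    acyclic G -> g e0 != 0 ->
  exists x, \sum_(e : edge G | x \in val e) g e != 0.
Proof.
move=> acyclicG g0.
pose S := [set x | [exists e : edge G, (g e != 0) && (x \in val e)]].
have inS e x : g e != 0 -> x \in val e -> x \in S.
  by move=> ge xe; rewrite inE; apply/existsP; exists e; rewrite ge.
have [|x Sx leafx] := acyclic_leaf acyclicG (S := S).
  have /edge_setP[x [y [_ e0E]]] := valP e0; apply/set0Pn; exists x.
  by apply: inS g0 _; rewrite e0E !inE eqxx.
move: Sx; rewrite inE => /existsP[e /andP[ge xe]]; exists x.
rewrite (bigD1 e) //= big1 ?addr0 // => f /andP[xf fe]; apply/eqP.
apply: contraNT fe => gf; apply/eqP/val_inj.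
have [y xy eE] := edge_at (valP e) xe; have [z xz fE] := edge_at (valP f) xf.
rewrite fE eE; congr [set x; _]; apply: leafx => //.
  by apply: inS gf _; rewrite fE !inE eqxx orbT.
by apply: inS ge _; rewrite eE !inE eqxx orbT.
Qed.

End Edges.

(** * Eigenvectors as functions on the vertices *)

Section Eigenfunctions.
Variable R : rcfType.

Lemma eigenvalue_funP (T : finType) (m : T -> T -> R) (a : R) :
  eigenvalue (\matrix_(i < #|T|, j < #|T|) m (enum_val i) (enum_val j)) a <->
  exists2 f : T -> R, (exists x, f x != 0)
    & forall y, \sum_x f x * m x y = a * f y.
Proof.
split=> [/eigenvalueP[v vM v0] | [f [x fx] fm]].
  exists (fun x => v 0 (enum_rank x)).
    have /rV0Pn[i vi] := v0; exists (enum_val i).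
    by rewrite enum_valK.
  move=> y; have /rowP/(_ (enum_rank y)) := vM; rewrite !mxE => <-.
  rewrite (reindex _ (onW_bij _ (@enum_val_bij T))) /=.
  by apply: eq_bigr => i _; rewrite !mxE enum_valK enum_rankK.
apply/eigenvalueP; exists (\row_i f (enum_val i)).
  apply/rowP=> j; rewrite !mxE -fm (reindex _ (onW_bij _ (@enum_val_bij T))) /=.
  by apply: eq_bigr => i _; rewrite !mxE.
by apply/rV0Pn; exists (enum_rank x); rewrite mxE enum_rankK.
Qed.

Lemma eigenvalue_adjacencyP (G : sgraph) (a : R) :
  eigenvalue (adjacency R G) a <->
  exists2 f : G -> R, (exists x, f x != 0)
    & forall x, \sum_(y | adj x y) f y = a * f x.
Proof.
have sumE (f : G -> R) x : \sum_y f y * (adj y x)%:R = \sum_(y | adj x y) f y.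
  rewrite [RHS]big_mkcond; apply: eq_bigr => y _.
  by rewrite adj_sym; case: adj; rewrite ?mulr1 ?mulr0.
rewrite (eigenvalue_funP (fun x y : G => (adj x y)%:R)).
by split=> -[f f0 fa]; exists f => // x; rewrite -fa sumE.
Qed.

Lemma eigenvalue_laplacianP (G : sgraph) (a : R) :
  eigenvalue (laplacian R G) a <->
  exists2 f : G -> R, (exists x, f x != 0)
    & forall x, \sum_(y | adj x y) (f x - f y) = a * f x.
Proof.
pose m (x y : G) : R := (deg x)%:R *+ (x == y) - (adj x y)%:R.
have sumE (f : G -> R) x : \sum_y f y * m y x = \sum_(y | adj x y) (f x - f y).
  rewrite sumrB sumr_const /m.
  under eq_bigr do rewrite mulrBr.
  rewrite sumrB (bigD1 x) //= big1 => [|y /negbTE ->]; last by rewrite mulr0.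
  rewrite eqxx mulr1n addr0 mulr_natr /deg; congr (_ *+ _ - _).
    by apply: eq_card => y; rewrite !inE.
  rewrite [RHS]big_mkcond; apply: eq_bigr => y _.
  by rewrite adj_sym; case: adj; rewrite ?mulr1 ?mulr0.
have -> : laplacian R G = \matrix_(i, j) m (enum_val i) (enum_val j).
  apply/matrixP=> i j; rewrite !mxE /m (inj_eq enum_val_inj).
  by [].
rewrite (eigenvalue_funP m).
by split=> -[f f0 fa]; exists f => // x; rewrite -fa sumE.
Qed.

Lemma eigenvalue_adjacency_ge (G : sgraph) (f : G -> R) (x0 : G) (m : R) :
    f x0 != 0 ->
    m * \sum_x f x ^+ 2 <= \sum_x f x * \sum_(y | adj x y) f y ->
  exists2 a, eigenvalue (adjacency R G) a & m <= a.
Proof.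
move=> f0 lem; pose v := \row_i f (enum_val i) : 'rV[R]_#|G|.
apply: (eigenvalue_ge_rayleigh (v := v)).
- by apply/matrixP=> i j; rewrite !mxE adj_sym.
- by apply/rV0Pn; exists (enum_rank x0); rewrite mxE enum_rankK.
have -> : (v *m v^T) 0 0 = \sum_x f x ^+ 2.
  rewrite mxE (reindex _ (onW_bij _ (@enum_val_bij G))) /=.
  by apply: eq_bigr => i _; rewrite !mxE.
suff -> : (v *m adjacency R G *m v^T) 0 0 = \sum_x f x * \sum_(y | adj x y) f y.
  by [].
rewrite mxE (reindex _ (onW_bij _ (@enum_val_bij G))) /=.
apply: eq_bigr => i _; rewrite !mxE mulrC; congr (_ * _).
rewrite [RHS](reindex _ (onW_bij _ (@enum_val_bij G))) [RHS]big_mkcond /=.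
apply: eq_bigr => j _; rewrite !mxE adj_sym.
by case: adj; rewrite ?mulr1 ?mulr0.
Qed.

(** The Rayleigh bound for the constant function 1, with [m] its own quotient [Q / S], so that the
    required inequality is an equality. *)
Lemma eigenvalue_adjacency_exists (G : sgraph) :
  (0 < #|G|)%N -> exists a, eigenvalue (adjacency R G) a.
Proof.
case/card_gt0P=> x0 _; pose S := \sum_(x : G) (1 : R) ^+ 2.
have S0 : S != 0.
  rewrite /S; under eq_bigr do rewrite expr1n.
  by rewrite sumr_const pnatr_eq0 -lt0n; apply/card_gt0P; exists x0.
pose Q := \sum_(x : G) 1 * \sum_(y | adj x y) (1 : R).
have [||a Aa _] := @eigenvalue_adjacency_ge G (fun=> 1) x0 (Q / S).
- exact: oner_neq0.
- by rewrite -/S -/Q mulfVK.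
by exists a.
Qed.

(** Changing the sign of an eigenfunction on one colour class negates its eigenvalue. *)
Lemma eigenvalue_adjacency_opp (G : sgraph) (c : G -> bool) (a : R) :
    (forall x y, adj x y -> c x = ~~ c y) ->
  eigenvalue (adjacency R G) a -> eigenvalue (adjacency R G) (- a).
Proof.
move=> cP /eigenvalue_adjacencyP[f [x0 f0] fa].
apply/eigenvalue_adjacencyP; exists (fun x => (-1) ^+ c x * f x).
  by exists x0; rewrite mulf_neq0 ?signr_eq0.
move=> x; rewrite mulrCA mulNr -fa -sumrN mulr_sumr.
apply: eq_bigr => y /cP ->; rewrite signrN; case: (c y); ring.
Qed.

End Eigenfunctions.

(** * The nonzero Laplacian spectrum and the line graph *)

Section ForestSpectrum.
Variables (R : rcfType) (G : sgraph).
Hypothesis acyclicG : acyclic G.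

Let AL := adjacency R (line_graph G).

(** For an eigenfunction [g] and [h = N^T g], one has [(2 + a) |g|^2 = |h|^2], and [h] is nonzero by
    injectivity. *)
Lemma eigenvalue_line_graph_gt a : eigenvalue AL a -> 0 < 2 + a.
Proof.
case/eigenvalue_adjacencyP=> /= g [e0 g0] ga.
pose h x := \sum_(e : edge G | x \in val e) g e.
have hE (e : edge G) : \sum_(z in val e) h z = (2 + a) * g e.
  by rewrite sum_ends_edges_at ga; ring.
have [x hx] := acyclic_incidence_inj acyclicG g0.
have sqE : (2 + a) * \sum_(e : edge G) g e ^+ 2 = \sum_x h x ^+ 2.
  rewrite mulr_sumr.
  under eq_bigr do rewrite expr2 mulrA -hE mulr_suml.
  rewrite (exchange_big_dep xpredT) //=; apply: eq_bigr => z _.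
  by rewrite -mulr_sumr expr2.
have : 0 < \sum_x h x ^+ 2.
  apply: lt_le_trans (_ : h x ^+ 2 <= _); first by rewrite exprn_even_gt0.
  by rewrite (bigD1 x) //= lerDl sumr_ge0 // => z _; rewrite sqr_ge0.
rewrite -sqE => gt0.
suff g2 : 0 < \sum_(e : edge G) g e ^+ 2 by rewrite -(pmulr_lgt0 _ g2).
rewrite lt0r sumr_ge0 ?andbT => [|e _]; last exact: sqr_ge0.
by apply: contraTneq gt0 => ->; rewrite mulr0 ltxx.
Qed.

(** The eigenfunction is [N^T g] twisted by the colouring signs, which turn the differences in [L]
    into sums along edges. *)
Lemma eigenvalue_line_laplacian a :
  eigenvalue AL a -> eigenvalue (laplacian R G) (2 + a).
Proof.
case/eigenvalue_adjacencyP=> /= g [e0 g0] ga.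
have [c cP] := acyclic_bipartite acyclicG.
pose h x := \sum_(e : edge G | x \in val e) g e.
have [x0 hx0] := acyclic_incidence_inj acyclicG g0.
apply/eigenvalue_laplacianP; exists (fun x => (-1) ^+ c x * h x).
  by exists x0; rewrite mulf_neq0 ?signr_eq0.
move=> x; transitivity ((-1) ^+ c x * \sum_(y | adj x y) (h x + h y)).
  by rewrite [RHS]mulr_sumr; apply: eq_bigr => y /cP ->; rewrite signrN; ring.
rewrite -sum_edges_at_ends mulrCA; congr (_ * _).
rewrite [RHS]mulr_sumr; apply: eq_bigr => e _.
by rewrite sum_ends_edges_at ga; ring.
Qed.

(** Twist [f] to [u] and put [g = N u]. Since [N^T g = b u] with [b] nonzero, [g] does not
    vanish. *)
Lemma eigenvalue_laplacian_line b :
  b != 0 -> eigenvalue (laplacian R G) b -> eigenvalue AL (b - 2).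
Proof.
move=> b0 /eigenvalue_laplacianP[f [x0 f0] fb].
have [c cP] := acyclic_bipartite acyclicG.
pose u x := (-1) ^+ c x * f x; pose g (e : edge G) := \sum_(z in val e) u z.
have gE x : \sum_(e : edge G | x \in val e) g e = b * u x.
  rewrite sum_edges_at_ends /u mulrCA -fb mulr_sumr.
  by apply: eq_bigr => y /cP ->; rewrite signrN; ring.
apply/eigenvalue_adjacencyP; exists g.
  apply/existsP; apply: contraNT f0 => /existsPn g0.
  have : b * u x0 == 0.
    by rewrite -gE big1 // => e _; apply/eqP/negPn/g0.
  by rewrite !mulf_eq0 (negbTE b0) signr_eq0.
move=> /= e; have := sum_ends_edges_at e g.
have -> : \sum_(z in val e) \sum_(f : edge G | z \in val f) g f = b * g e.
  by rewrite mulr_sumr; apply: eq_bigr => z _; apply: gE.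
by rewrite mulrBl => ->; ring.
Qed.

End ForestSpectrum.

(** * Line graphs of paths and of stars, and the theorem *)

Lemma path_line_graph_bipartite (G : sgraph) : is_path_graph G ->
  exists c : edge G -> bool, forall e f, share_vertex e f -> c e = ~~ c f.
Proof.
case=> f [[k kK fK] fadj].
have edgeE (e : edge G) : exists i j : 'I_#|G|,
    val e = [set f i; f j] /\ j = i.+1 :> nat.
  have /edge_setP[x [y [xy eE]]] := valP e; move: xy eE.
  rewrite -(fK x) -(fK y) fadj => /orP[] /eqP xy ->.
    by exists (k x), (k y).
  by exists (k y), (k x); rewrite setUC.
(* For the edge joining positions [i] and [i + 1], [s e = 2i + 1], so [(s e)./2] recovers [i]
   without orienting the edge. Distinct edges that meet have consecutive [i], so the parity of [i]
   is a proper colouring. *)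
pose s (e : edge G) := (\sum_(z in val e) k z : nat)%N.
have sE (e : edge G) (i j : 'I_#|G|) :
    val e = [set f i; f j] -> j = i.+1 :> nat -> s e = (i + j)%N.
  move=> eE ij; rewrite /s eE.
  rewrite big_setU1 ?big_set1 /= ?kK // inE (can_eq kK).
  by rewrite -val_eqE /= ij ltn_eqF.
exists (fun e => odd (s e)./2) => e e' /andP[ee' /set0Pn[z]].
have [i [j [eE ij]]] := edgeE e; have [i' [j' [eE' ij']]] := edgeE e'.
rewrite (sE _ _ _ eE ij) (sE _ _ _ eE' ij') ij ij'.
have neq : i <> i' :> nat.
  move=> ii'; case/eqP: ee'; apply: val_inj; rewrite eE eE'.
  have -> : i = i' by apply: val_inj.
  by have -> : j = j' by apply: val_inj; rewrite /= ij ij' ii'.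
rewrite eE eE' !inE => /andP[/orP[]/eqP-> /orP[]/eqP/(can_inj kK)/(congr1 (@nat_of_ord _))];
  lia.
Qed.

Lemma line_graph_ge2 (R : rcfType) (G : sgraph) (x : G) : (2 < deg x)%N ->
  exists2 a, eigenvalue (adjacency R (line_graph G)) a & 2 <= a.
Proof.
(* Rayleigh quotient of the indicator function of the star at [x] *)
move=> degx; pose d : R := (deg x)%:R.
have sumd : \sum_(e : edge G | x \in val e) 1 = d.
  rewrite (sum_edges_at x (fun=> 1)) sumr_const; congr (_%:R).
  by apply: eq_card => y; rewrite !inE.
have [y xy] : exists y, adj x y.
  have /card_gt0P[y] : (0 < deg x)%N by apply: leq_trans degx.
  by rewrite inE => xy; exists y.
have e0P : [set x; y] \in edge_set G by apply/edge_setP; exists x, y.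
pose f (e : line_graph G) : R := (x \in val e)%:R.
have sumf (F : line_graph G -> R) :
    \sum_e f e * F e = \sum_(e : edge G | x \in val e) F e.
  rewrite [RHS]big_mkcond; apply: eq_bigr => e _.
  by rewrite /f; case: (x \in _); rewrite ?mul1r ?mul0r.
pose e0 : line_graph G := exist (fun E => E \in edge_set G) _ e0P.
apply: (@eigenvalue_adjacency_ge R (line_graph G) f e0).
  by rewrite /f /= !inE eqxx oner_neq0.
under eq_bigr do rewrite expr2; rewrite !sumf /=.
rewrite mulr_sumr; apply: ler_sum => e xe.
(* The edge [e] meets each of the other [d - 1] edges of the star at [x], and [d - 1 >= 2]. *)
have -> : \sum_(e' | share_vertex e e') f e' = d - 1.
  rewrite -sumd [X in _ = X - 1](bigD1 e) //= addrAC subrr add0r [LHS]big_mkcond [RHS]big_mkcond.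
  apply: eq_bigr => e' _; rewrite /share_vertex /f eq_sym.
  case xe': (x \in val e'); last by rewrite if_same.
  have -> : val e :&: val e' != set0 by apply/set0Pn; exists x; rewrite inE xe.
  by rewrite andbT.
have : (3%:R : R) <= d by rewrite ler_nat.
by rewrite /f xe mulr1; lra.
Qed.

Theorem proposition8p2 (R : rcfType) (T : sgraph)
    (hT : is_tree T) (hE : (0 < #|edge_set T|)%N) :
  [/\ lambda_1 (laplacian R T) = 2 + lambda_min (adjacency R (line_graph T)),
      lambda_max (laplacian R T) = 2 + lambda_max (adjacency R (line_graph T))
    & lambda_1 (laplacian R T) = 2 - lambda_max (adjacency R (line_graph T))
      <-> is_path_graph T].
Proof.
have [connT acyclicT] := hT.
set L := laplacian R T; set A := adjacency R (line_graph T).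
(* An eigenvalue must exist for the extremal ones to be genuine rather than the default 0; [hE]
   provides a vertex of the line graph. *)
have [a Aa] : exists a, eigenvalue A a.
  by apply: eigenvalue_adjacency_exists; rewrite /= card_sig.
have [Amin _] := lambda_minP Aa; have [Amax _] := lambda_maxP Aa.
have A_gt b : eigenvalue A b -> 0 < 2 + b by apply: eigenvalue_line_graph_gt.
have AL b : eigenvalue A b -> eigenvalue L (2 + b).
  exact: eigenvalue_line_laplacian.
have LA b : b != 0 -> eigenvalue L b -> eigenvalue A (b - 2).
  exact: eigenvalue_laplacian_line.
have A_neq0 b Ab := lt0r_neq0 (A_gt b Ab).
have [L1 L1_neq0 L1_le] := lambda_1P (AL _ Amin) (A_neq0 _ Amin).
have L1E : lambda_1 L = 2 + lambda_min A.
  by apply/le_anti; rewrite L1_le -lerBrDl; case: (lambda_minP (LA _ L1_neq0 L1)).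
have [Lmax Lmax_ge] := lambda_maxP (AL _ Amax).
(* Only nonzero eigenvalues of [L] transfer back to [A]; this one is at least
   [2 + lambda_max A > 0]. *)
have Lmax_neq0 := lt0r_neq0 (lt_le_trans (A_gt _ Amax) Lmax_ge).
have LmaxE : lambda_max L = 2 + lambda_max A.
  apply/le_anti; rewrite Lmax_ge andbT -lerBlDl.
  by case: (lambda_maxP (LA _ Lmax_neq0 Lmax)).
split=> //; split=> [L1E' | pathT].
  apply: path_graph_of_deg_le2 => // x; rewrite leqNgt; apply/negP => degx.
  have [b /lambda_maxP[_ le_max] ge2] := line_graph_ge2 R degx.
  (* The identity turns [0 < 2 + lambda_min A] into [lambda_max A < 2], against the star bound. *)
  have := A_gt _ Amin; rewrite -L1E L1E' subr_gt0 ltNge.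
  by rewrite (le_trans ge2).
have [c cP] := path_line_graph_bipartite pathT.
have Aopp b : eigenvalue A b -> eigenvalue A (- b).
  exact: (eigenvalue_adjacency_opp (G := line_graph T) cP).
(* It remains to see [lambda_min A = - lambda_max A], which follows from the symmetry [Aopp] of the
   spectrum. *)
rewrite L1E; congr (2 + _); apply/le_anti.
have [_ ->] := lambda_minP (Aopp _ Amax).
by rewrite lerNl; have [_ ->] := lambda_maxP (Aopp _ Amin).
Qed.
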